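(* For every real $q$ with $2\leq q<\infty$, every real $p$ with $1\leq p\leq q$, every even integer $m\geq 4$, every integer $n\ge 1$ with $n\leq m^q$, and every mapping $f:\mathbb{Z}_m^n\to L_1$ (where $L_1=L_1(\Omega,\mu)$ is any real or complex $L_1$ space), $$\sum_{j=1}^n\mathbb{E}_x\left\|f\left(x+\tfrac m2e_j\right)-f(x)\right\|_1^p\leq 11^p\,m^p\,n^{1-p/q}\,\mathbb{E}_{x,\varepsilon}\|f(x+\varepsilon)-f(x)\|_1^p.$$ Consequently, $$m_q^{(p)}(L_1;n,11)\leq 6\,n^{1/q}\qquad\text{for all } q\geq 2,\ 1\leq p\leq q,\ n\in\mathbb{N}.$$ In particular, $m_2(L_1;n,11)\leq 6\sqrt n$ for all $n\in\mathbb{N}$.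
   Context: $\mathbb{Z}_m=\mathbb{Z}/m\mathbb{Z}$, and $e_1,\dots,e_n$ are the standard coordinate vectors of $\mathbb{Z}_m^n$. The variable $x$ is uniform on $\mathbb{Z}_m^n$, $\varepsilon$ is uniform on $\{-1,0,1\}^n$, and $x,\varepsilon$ are independent; $\mathbb{E}_x$ and $\mathbb{E}_{x,\varepsilon}$ are the corresponding expectations. $\|\cdot\|_1$ is the norm of $L_1(\Omega,\mu)$, with $(\Omega,\mu)$ a measure space. For a metric space $(\mathcal{M},d_{\mathcal{M}})$, $n\in\mathbb{N}$, $\Gamma<\infty$ and $1\le p\le q$, $m_q^{(p)}(\mathcal{M};n,\Gamma)$ denotes the smallest positive even integer $m$ for which every $f:\mathbb{Z}_m^n\to\mathcal{M}$ satisfies $$\sum_{j=1}^n\mathbb{E}_x\,d_{\mathcal{M}}\left(f\left(x+\tfrac m2e_j\right),f(x)\right)^p\leq\Gamma^pm^pn^{1-p/q}\,\mathbb{E}_{x,\varepsilon}\,d_{\mathcal{M}}(f(x+\varepsilon),f(x))^p,$$ with the convention that it is $+\infty$ if no such $m$ exists. One writes $m_q(\mathcal{M};n,\Gamma)=m_q^{(q)}(\mathcal{M};n,\Gamma)$. For $\mathcal{M}=L_1$ the inequality is required for all maps into all $L_1(\Omega,\mu)$ spaces. *)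

(* Defs.v *)
From HB Require Import structures.
From mathcomp Require Import all_boot all_order all_algebra.
From mathcomp Require Import complex.
From mathcomp Require Import all_classical all_reals all_analysis.
From mathcomp Require Import measurable_realfun.

Set Implicit Arguments.
Unset Strict Implicit.
Unset Printing Implicit Defensive.

Import Order.TTheory GRing.Theory Num.Theory.
Import numFieldNormedType.Exports.
Import Normc.

Local Open Scope classical_set_scope.
Local Open Scope quotient_scope.
Local Open Scope complex_scope.
Local Open Scope ring_scope.

(* An element of LspaceType1 mu is an a.e. class; as a function it is a chosen
   representative of the class. *)
Section real_L1.
Context d (T : measurableType d) (R : realType).
Variable mu : {measure set T -> \bar R}.
Implicit Types f g h : LspaceType1 mu.

HB.instance Definition _ := gen_eqMixin (LspaceType1 mu).
HB.instance Definition _ := gen_choiceMixin (LspaceType1 mu).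

Definition L1_dist f g : R := fine ('N[mu]_1[(fun x => (f x - g x)%:E)])%E.

Lemma L1_measurable f : measurable_fun setT (f : T -> R).
Proof.
exact: (@measurable_funPT _ _ _ _
  (repr (f : {mfun_ mu, T >-> measurableTypeR R}))).
Qed.

Lemma L1_measurableB f g : measurable_fun setT (fun x => f x - g x : R).
Proof. by apply: measurable_funB; exact: L1_measurable. Qed.

Lemma L1_finite f : ('N[mu]_1[(fun x => (f x)%:E)] < +oo)%E.
Proof. exact: (@Lebesgue_finite _ _ _ _ _ _ f). Qed.

Lemma L1_distE f g : (L1_dist f g)%:E = 'N[mu]_1[(fun x => (f x - g x)%:E)]%E.
Proof.
rewrite /L1_dist fineK// ge0_fin_numE ?Lnorm_ge0//.
rewrite (@le_lt_trans _ _ ('N[mu]_1[(fun x => (f x)%:E)]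
    + 'N[mu]_1[(fun x => (g x)%:E)])%E)//; last first.
  by rewrite lte_add_pinfty//; exact: L1_finite.
rewrite !Lnorm1 -ge0_integralD//=;
  [|by do 2 apply: measurableT_comp => //; exact: L1_measurable..].
apply: ge0_le_integral => //=.
- by do 2 apply: measurableT_comp => //; exact: L1_measurableB.
- by apply: emeasurable_funD; do 2 apply: measurableT_comp => //;
    exact: L1_measurable.
- by move=> x _; rewrite lee_fin ler_normB.
Qed.

Lemma L1_distxx f : L1_dist f f = 0.
Proof.
apply: EFin_inj; rewrite L1_distE Lnorm1 integral0_eq// => x _.
by rewrite subrr abse0.
Qed.

Lemma L1_eq_ae f g : (f : T -> R) = g %[ae mu] -> f = g.
Proof.
move=> fg.
have {fg} fg : f = g :> {mfun_ mu, T >-> measurableTypeR R}.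
  by rewrite -[LHS]reprK -[RHS]reprK; apply/eqP; rewrite eqmodE; exact/asboolP.
case: f g fg => f [[ff]] [g [[gg]]] /= fg.
by case: _ / fg in gg *; rewrite (bool_irrelevance ff gg).
Qed.

Lemma L1_dist_eq0 f g : L1_dist f g = 0 -> f = g.
Proof.
move=> fg0; apply: L1_eq_ae; have := L1_distE f g; rewrite fg0 => /esym.
have /measurable_EFinP mfg := L1_measurableB f g.
move=> /(Lnorm_eq0_eq0 mfg lte01); apply: filterS => x /(_ I) /= [] /subr0_eq.
by [].
Qed.

Lemma L1_distC f g : L1_dist f g = L1_dist g f.
Proof.
apply: EFin_inj; rewrite !L1_distE !Lnorm1.
by apply: eq_integral => x _ /=; rewrite distrC.
Qed.

Lemma L1_dist_triangle g f h : L1_dist f h <= L1_dist f g + L1_dist g h.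
Proof.
rewrite -lee_fin EFinD !L1_distE !Lnorm1 -ge0_integralD//=;
  [|by do 2 apply: measurableT_comp => //; exact: L1_measurableB..].
apply: ge0_le_integral => //=.
- by do 2 apply: measurableT_comp => //; exact: L1_measurableB.
- by apply: emeasurable_funD; do 2 apply: measurableT_comp => //;
    exact: L1_measurableB.
- by move=> x _; rewrite lee_fin ler_distD.
Qed.

HB.instance Definition _ := isMetric.Build R (LspaceType1 mu)
  L1_distxx L1_dist_eq0 L1_distC L1_dist_triangle.

Lemma L1_mdistE f g : mdist f g = fine ('N[mu]_1[(fun x => (f x - g x)%:E)])%E.
Proof. by []. Qed.

End real_L1.

Section complex_measurable.
Variable R : realType.

HB.instance Definition _ := isPointed.Build R[i] 0.

(* The Borel sets of the plane, carried over to R[i] by (x, y) |-> x + iy. *)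
Definition complex_measurable : set (set R[i]) :=
  [set A | measurable ((fun z : R * R => z.1 +i* z.2) @^-1` A)].

Lemma complex_measurable0 : complex_measurable set0.
Proof. exact: measurable0. Qed.

Lemma complex_measurableC A : complex_measurable A -> complex_measurable (~` A).
Proof. exact: measurableC. Qed.

Lemma complex_measurable_bigcup (F : (set R[i])^nat) :
  (forall i, complex_measurable (F i)) -> complex_measurable (\bigcup_i F i).
Proof.
move=> mF; rewrite /complex_measurable /= preimage_bigcup.
by apply: bigcupT_measurable => i; exact: mF.
Qed.

HB.instance Definition _ := isMeasurable.Build default_measure_display R[i]
  complex_measurable0 complex_measurableC complex_measurable_bigcup.

Lemma measurable_Re : measurable_fun setT (@complex.Re R).
Proof.
move=> _ A mA; have := @measurable_fst _ _ R R measurableT A mA.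
by rewrite !setTI.
Qed.

Lemma measurable_Im : measurable_fun setT (@complex.Im R).
Proof.
move=> _ A mA; have := @measurable_snd _ _ R R measurableT A mA.
by rewrite !setTI.
Qed.

End complex_measurable.

Section complex_L1.
Context d (T : measurableType d) (R : realType).
Variable mu : {measure set T -> \bar R}.

Definition complexL1 : Type := {f : {mfun_ mu, T >-> R[i]} |
  ('N[mu]_1[(fun x => (normc (f x))%:E)] < +oo)%E}.

HB.instance Definition _ := gen_eqMixin complexL1.
HB.instance Definition _ := gen_choiceMixin complexL1.

Implicit Types f g h : complexL1.

Definition complexL1_dist f g : R :=
  fine ('N[mu]_1[(fun x => (normc (sval f x - sval g x))%:E)])%E.

Lemma normc_ge0 (z : R[i]) : 0 <= normc z.
Proof. by case: z => a b /=; exact: sqrtr_ge0. Qed.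

Lemma normcE (z : R[i]) :
  normc z = Num.sqrt (complex.Re z ^+ 2 + complex.Im z ^+ 2).
Proof. by case: z. Qed.

Lemma normc_dist (x y z : R[i]) :
  normc (x - z) <= normc (x - y) + normc (y - z).
Proof. by rewrite (le_trans _ (le_normcD _ _))// subrKA. Qed.

Lemma measurable_normc : measurable_fun setT (@normc R).
Proof.
rewrite (_ : @normc R = (fun z =>
  Num.sqrt (complex.Re z ^+ 2 + complex.Im z ^+ 2))); last exact/funext/normcE.
apply: (measurableT_comp (continuous_measurable_fun (@sqrt_continuous R))).
by apply: measurable_funD; apply: measurable_funX;
  [exact: measurable_Re|exact: measurable_Im].
Qed.

Lemma complexL1_measurable f : measurable_fun setT (sval f : T -> R[i]).
Proof. exact: (@measurable_funPT _ _ _ _ (repr (sval f))). Qed.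

Lemma complexL1_measurable_norm f :
  measurable_fun setT (fun x => normc (sval f x)).
Proof.
apply: measurableT_comp; first exact: measurable_normc.
exact: complexL1_measurable.
Qed.

Lemma complexL1_measurableB f g :
  measurable_fun setT (fun x => normc (sval f x - sval g x)).
Proof.
rewrite (_ : (fun x => _) = (fun x => Num.sqrt
  ((complex.Re (sval f x) - complex.Re (sval g x)) ^+ 2
   + (complex.Im (sval f x) - complex.Im (sval g x)) ^+ 2))).
  apply: (measurableT_comp (continuous_measurable_fun (@sqrt_continuous R))).
  apply: measurable_funD; apply: measurable_funX; apply: measurable_funB;
    (apply: measurableT_comp; last exact: complexL1_measurable);
    solve [exact: measurable_Re|exact: measurable_Im].
by apply/funext => x; rewrite normcE; case: (sval f x) (sval g x) => [? ?] [].
Qed.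

Lemma complexL1_distE f g : (complexL1_dist f g)%:E =
  'N[mu]_1[(fun x => (normc (sval f x - sval g x))%:E)]%E.
Proof.
rewrite /complexL1_dist fineK// ge0_fin_numE ?Lnorm_ge0//.
rewrite (@le_lt_trans _ _ ('N[mu]_1[(fun x => (normc (sval f x))%:E)]
    + 'N[mu]_1[(fun x => (normc (sval g x))%:E)])%E)//; last first.
  by rewrite lte_add_pinfty//; [exact: (svalP f)|exact: (svalP g)].
rewrite !Lnorm1 -ge0_integralD//=;
  [|by do 2 apply: measurableT_comp => //; exact: complexL1_measurable_norm..].
apply: ge0_le_integral => //=.
- by do 2 apply: measurableT_comp => //; exact: complexL1_measurableB.
- by apply: emeasurable_funD; do 2 apply: measurableT_comp => //;
    exact: complexL1_measurable_norm.
- move=> x _; rewrite lee_fin !ger0_norm ?normc_ge0//.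
  by rewrite (le_trans (le_normcD _ _))// normcN.
Qed.

Lemma complexL1_distxx f : complexL1_dist f f = 0.
Proof.
apply: EFin_inj; rewrite complexL1_distE Lnorm1 integral0_eq// => x _.
by rewrite subrr normc0 abse0.
Qed.

Lemma complexL1_dist_eq0 f g : complexL1_dist f g = 0 -> f = g.
Proof.
move=> fg0; apply: val_inj => /=; rewrite -[LHS]reprK -[RHS]reprK; apply/eqP.
rewrite eqmodE; apply/asboolP; have := complexL1_distE f g.
have /measurable_EFinP mfg := complexL1_measurableB f g.
rewrite fg0 => /esym /(Lnorm_eq0_eq0 mfg lte01).
by apply: filterS => x /(_ I) /= [] /eq0_normc /subr0_eq.
Qed.

Lemma complexL1_distC f g : complexL1_dist f g = complexL1_dist g f.
Proof.
apply: EFin_inj; rewrite !complexL1_distE !Lnorm1.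
by apply: eq_integral => x _ /=; rewrite -normcN opprB.
Qed.

Lemma complexL1_dist_triangle g f h :
  complexL1_dist f h <= complexL1_dist f g + complexL1_dist g h.
Proof.
rewrite -lee_fin EFinD !complexL1_distE !Lnorm1 -ge0_integralD//=;
  [|by do 2 apply: measurableT_comp => //; exact: complexL1_measurableB..].
apply: ge0_le_integral => //=.
- by do 2 apply: measurableT_comp => //; exact: complexL1_measurableB.
- by apply: emeasurable_funD; do 2 apply: measurableT_comp => //;
    exact: complexL1_measurableB.
- by move=> x _; rewrite lee_fin !ger0_norm ?normc_ge0// normc_dist.
Qed.

HB.instance Definition _ := isMetric.Build R complexL1
  complexL1_distxx complexL1_dist_eq0 complexL1_distC complexL1_dist_triangle.

Lemma complexL1_mdistE f g :
  mdist f g = fine ('N[mu]_1[(fun x => (normc (sval f x - sval g x))%:E)])%E.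
Proof. by []. Qed.

End complex_L1.

(* The scalar field is R in the first case and R[i] in the second. *)
Inductive is_L1 (R : realType) : metricType R -> Prop :=
| real_is_L1 d (T : measurableType d) (mu : {measure set T -> \bar R}) :
    is_L1 (LspaceType1 mu)
| complex_is_L1 d (T : measurableType d) (mu : {measure set T -> \bar R}) :
    is_L1 (complexL1 mu).

Section metric_cotype.
Variable R : realType.

Definition mean (I : finType) (F : I -> R) : R := (\sum_i F i) / #|I|%:R.

(* The element e of {0,1,2}^n encodes the sign vector e - (1,...,1) of
   {-1,0,1}^n, whose image in Z_m^n this is. The average is over sign vectors
   and not over their images, which coincide more often when m = 2. *)
Definition sign_vector m n (e : {ffun 'I_n -> 'I_3}) : 'rV['Z_m]_n :=
  \row_i ((e i)%:Z - 1)%:~R.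

Definition cotype_ineq (M : metricType R) (p q Gamma : R) (m n : nat)
    (f : 'rV['Z_m]_n -> M) : Prop :=
  \sum_(j < n) mean (fun x => mdist (f (x + delta_mx 0 j *+ m./2)) (f x) `^ p)
  <= Gamma `^ p * m%:R `^ p * n%:R `^ (1 - p / q) *
     mean (fun xe : 'rV['Z_m]_n * {ffun 'I_n -> 'I_3} =>
       mdist (f (xe.1 + sign_vector m xe.2)) (f xe.1) `^ p).

(* Restricting to positive even m also makes 'Z_m the ring Z/mZ, which it is
   not for m = 0 and m = 1. *)
Definition cotype_scale (C : metricType R -> Prop) (p q : R) (n : nat)
    (Gamma : R) : pred nat :=
  fun m => [&& (0 < m)%N, ~~ odd m &
    `[< forall M : metricType R, C M ->
        forall f : 'rV['Z_m]_n -> M, cotype_ineq p q Gamma f >]].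

(* m_q^(p)(C; n, Gamma), where the inequality is required for all maps into
   all members of the class C of metric spaces. *)
Definition cotype_const_p (C : metricType R -> Prop) (p q : R) (n : nat)
    (Gamma : R) : \bar R :=
  if pselect (exists m, cotype_scale C p q n Gamma m) is left exm
  then (ex_minn exm)%:R%:E else +oo%E.

Definition cotype_const (C : metricType R -> Prop) (q : R) (n : nat)
    (Gamma : R) : \bar R :=
  cotype_const_p C q q n Gamma.

End metric_cotype.

(* Main.v *)
Require Import Defs.
From HB Require Import structures.
From mathcomp Require Import all_boot all_order all_algebra.
From mathcomp Require Import all_classical all_reals all_analysis.
From mathcomp Require Import measurable_realfun complex ring lra.

(** The metrics that L_1 induces on a finite set are the nonnegative combinations
    of cut metrics [|1_S x - 1_S y|], so f may be replaced by a family of subsets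
    S of G = Z_m^n with weights w_S ([L1_cut_dist]); the complex case costs a factor
    2 / sqrt 3, because the hexagonal norm on C is equivalent to the modulus within
    that factor and comes from three real functionals ([hexagonal_normc]).

    A single cut is smoothed nonlinearly. For a direction j, let a(x) be the density
    of S in x + {-1,0,1}^n with the j-th coordinate frozen at 0, and replace 1_S by
    psi(a) where psi(a) = 3 a^2 - 2 a^3 is the probability that the majority of three
    independent samples falls in S. The displacement by (m/2) e_j then splits into
    two errors |1_S - psi(a)| and about m/4 increments of psi(a) along 2 e_j.

    - Error. Since psi(a) <= 9a/8 and 1 - psi(a) = psi(1 - a), the error at x is at
      most 9/8 of the mean of |1_S(x + eps) - 1_S(x)| over the signs eps whose j-th
      coordinate is frozen. Freezing a coordinate costs at most 3, and the n errors
      are summed using n <= m^p n^(1-p/q), which is the hypothesis n <= m^q.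

    - Increment. The increments of the linear average of 1_S in the n directions are
      multiples of level-1 Fourier coefficients on {-1,0,1}^n, and Bessel bounds the
      sum of their squares by 3/2 times the variance K = a(1 - a), a being now the
      density with no coordinate frozen ([level1_inequality]).
      That is too weak for a sparse S: sqrt K is much larger than the mean of
      |1_S(x + eps) - 1_S(x)|. The slope of psi repairs this, because it contributes
      another factor of order K: the l2-norm of the increments is at most
      sqrt(243/2) K <= 276/25 K, and K is at most that mean ([smoothing_gradient]).
      This bound is pointwise in x and in S, hence survives integration over S by
      Minkowski's inequality (L_1 has cotype 2) and then p-th powers and the mean
      over x; passing from l2 to l_p in j gives n^(1-p/q).

    Adding up, the constant for cut metrics is 2 * 27/8 + 276/100 = 951/100, and
    951/100 * 2 / sqrt 3 <= 11. *)

Set Implicit Arguments.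
Unset Strict Implicit.
Unset Printing Implicit Defensive.

Import Order.TTheory GRing.Theory Num.Theory.
Import numFieldNormedType.Exports Normc.

Local Open Scope ring_scope.

(** * Power means *)

Section power_means.
Variable R : realType.
Implicit Types p q : R.

(** The supporting line of the convex power function, read off Young's inequality
    for [y] and [x `^ (p - 1)]. *)
Lemma powR_tangent p (x y : R) : 1 <= p -> 0 <= x -> 0 <= y ->
  x `^ p + p * x `^ (p - 1) * (y - x) <= y `^ p.
Proof.
rewrite le_eqVlt => /predU1P[<-|p1] x0 y0.
  by rewrite subrr powRr0 !mul1r !powRr1// subrKC.
have p0 : 0 < p by lra.
have q0 : 0 < p / (p - 1) by apply: divr_gt0 => //; lra.
have := conjugate_powR y0 (powR_ge0 x (p - 1)) p0 q0.
have -> : p^-1 + (p / (p - 1))^-1 = 1 by field; apply/andP; split; lra.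
move=> /(_ erefl); rewrite -powRrM.
have -> : (p - 1) * (p / (p - 1)) = p by field; lra.
rewrite -(mulr_powRB1 x0 p0) => young.
have -> : x * x `^ (p - 1) + p * x `^ (p - 1) * (y - x) =
    p * (y * x `^ (p - 1)) - (p - 1) * (x * x `^ (p - 1)) by ring.
rewrite lerBlDr; apply: (le_trans (ler_wpM2l (ltW p0) young)).
rewrite le_eqVlt; apply/orP; left; apply/eqP; field.
by apply/andP; split; lra.
Qed.

Lemma powR_jensen (I : finType) p (a u : I -> R) : 1 <= p ->
  (forall i, 0 <= a i) -> \sum_i a i = 1 -> (forall i, 0 <= u i) ->
  (\sum_i a i * u i) `^ p <= \sum_i a i * u i `^ p.
Proof.
move=> p1 a0 a1 u0; set x := \sum_i a i * u i.
have x0 : 0 <= x by apply: sumr_ge0 => i _; exact: mulr_ge0.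
have -> : x `^ p = \sum_i a i * (x `^ p + p * x `^ (p - 1) * (u i - x)).
  under eq_bigr => i _ do rewrite mulrDr mulrCA mulrBr.
  by rewrite big_split/= -mulr_suml -mulr_sumr sumrB -mulr_suml a1 !mul1r
    subrr mulr0 addr0.
by apply: ler_sum => i _; apply: ler_wpM2l => //; exact: powR_tangent.
Qed.

(** Minkowski's inequality in l_p(Y), phrased with p-th powers only: Jensen with
    the weights [A i / \sum_i A i], applied to [u i y / A i]. The factor [V] keeps
    the common normalization of the bounds out of the way. *)
Lemma sum_powR_minkowski (I Y : finType) p (A : I -> R) (u : I -> Y -> R) (V : R) :
  1 <= p -> (forall i, 0 < A i) -> (forall i y, 0 <= u i y) ->
  (forall i, \sum_y u i y `^ p <= A i `^ p * V) ->
  \sum_y (\sum_i u i y) `^ p <= (\sum_i A i) `^ p * V.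
Proof.
move=> p1 A0 u0 uA; set S := \sum_i A i.
have p0 : p != 0 by lra.
have [S0|S0] := eqVneq S 0.
  rewrite S0 powR0// mul0r big1// => y _; rewrite big1 ?powR0// => i _.
  by have := A0 i; rewrite lt0r (psumr_eq0P _ S0 (i := i)) ?eqxx// => j _;
    exact/ltW.
have Sp : 0 < S by rewrite lt0r S0 sumr_ge0// => i _; exact/ltW.
have step y : (\sum_i u i y) `^ p <=
    S `^ p * \sum_i A i / S * (u i y / A i) `^ p.
  have -> : \sum_i u i y = S * \sum_i A i / S * (u i y / A i).
    rewrite mulr_sumr; apply: eq_bigr => i _; field.
    by rewrite S0 gt_eqF.
  have B0 i : 0 <= A i / S by rewrite divr_ge0 ?ltW.
  have C0 i : 0 <= u i y / A i by rewrite divr_ge0 ?u0 ?ltW.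
  rewrite powRM ?(ltW Sp) ?sumr_ge0// => [|i _]; last exact: mulr_ge0.
  rewrite ler_wpM2l ?powR_ge0// powR_jensen//.
  by rewrite -mulr_suml divff.
apply: (le_trans (ler_sum _ (fun y _ => step y))).
rewrite -mulr_sumr ler_wpM2l ?powR_ge0//.
rewrite exchange_big/= -[leRHS]mul1r.
have -> : 1 = \sum_i A i / S by rewrite -mulr_suml divff.
rewrite mulr_suml; apply: ler_sum => i _.
rewrite -mulr_sumr ler_wpM2l ?divr_ge0 ?(ltW Sp) ?(ltW (A0 i))//.
have -> : \sum_y (u i y / A i) `^ p = (A i `^ p)^-1 * \sum_y u i y `^ p.
  rewrite mulr_sumr; apply: eq_bigr => y _.
  by rewrite powRM ?u0 ?invr_ge0 ?(ltW (A0 i))// mulrC -powR_inv1 ?(ltW (A0 i))//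
    powRAC powR_inv1 ?powR_ge0.
by rewrite ler_pdivrMl ?powR_gt0.
Qed.

(** The l_p norm is at most n^(1/p-1/q) times the l_q norm, by Jensen for the
    exponent q/p, and the l_q norm is at most the l_2 norm as q >= 2. *)
Lemma sum_powR_le_l2 n p q (u : 'I_n -> R) (L : R) :
  1 <= p -> p <= q -> 2 <= q -> (0 < n)%N -> (forall j, 0 <= u j) -> 0 <= L ->
  \sum_j u j ^+ 2 <= L ^+ 2 ->
  \sum_j u j `^ p <= n%:R `^ (1 - p / q) * L `^ p.
Proof.
move=> p1 pq q2 n0 u0 L0 uL.
have nR : 0 < n%:R :> R by rewrite ltr0n.
have uq : \sum_j u j `^ q <= L `^ q.
  have split2 (x : R) : 0 <= x -> x `^ q = x ^+ 2 * x `^ (q - 2).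
    move=> x0; rewrite -powR_mulrn// -powRD ?subrKC//.
    by apply/implyP => /eqP; lra.
  rewrite (split2 L)//.
  apply: (@le_trans _ _ ((\sum_j u j ^+ 2) * L `^ (q - 2))).
    rewrite mulr_suml; apply: ler_sum => j _; rewrite split2//.
    apply: ler_wpM2l; first exact: sqr_ge0.
    apply: ge0_ler_powR; rewrite ?nnegrE//; first lra.
    rewrite -(ler_pXn2r (n := 2))// ?nnegrE//; apply: le_trans uL.
    by rewrite (bigD1 j)//= lerDl sumr_ge0// => i _; exact: sqr_ge0.
  by rewrite ler_wpM2r ?powR_ge0.
have q0 : 0 < q by lra.
have pne : p != 0 by lra.
have qne : q != 0 by lra.
have qp1 : 1 <= q / p by rewrite ler_pdivlMr ?mul1r//; lra.
have := @powR_jensen 'I_n (q / p) (fun=> n%:R^-1) (fun j => u j `^ p) qp1.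
have ninv : 0 <= n%:R^-1 :> R by rewrite invr_ge0 ltW.
have n1 : \sum_(j < n) n%:R^-1 = 1 :> R.
  by rewrite sumr_const card_ord -[LHS]mulr_natr mulVf ?gt_eqF.
move=> /(_ (fun=> ninv) n1).
move=> /(_ (fun=> powR_ge0 _ _)).
rewrite -!mulr_sumr; under [X in _ <= _ * X]eq_bigr => j _.
  rewrite -powRrM (_ : p * (q / p) = q); last by field.
  over.
set s := \sum_j u j `^ p; rewrite /= => jen.
have s0 : 0 <= s by apply: sumr_ge0 => j _; exact: powR_ge0.
have {jen} : (n%:R^-1 * s) `^ (q / p) <= n%:R^-1 * L `^ q.
  by rewrite (le_trans jen)// ler_wpM2l// invr_ge0 ltW.
have pq0 : 0 <= p / q by apply: divr_ge0; lra.
have ns0 : 0 <= n%:R^-1 * s by exact: mulr_ge0.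
have nL0 : 0 <= n%:R^-1 * L `^ q by rewrite mulr_ge0 ?powR_ge0.
move=> jen; have {jen} : (n%:R^-1 * s) `^ (q / p) `^ (p / q) <=
    (n%:R^-1 * L `^ q) `^ (p / q).
  by apply: ge0_ler_powR; rewrite ?nnegrE ?powR_ge0.
rewrite -powRrM (_ : q / p * (p / q) = 1); last first.
  by field; rewrite pne qne.
rewrite powRr1 ?mulr_ge0 ?invr_ge0 ?(ltW nR)//.
rewrite ler_pdivrMl// => /le_trans; apply.
rewrite powRM ?powR_ge0 ?invr_ge0 ?(ltW nR)// -powRrM.
rewrite (_ : q * (p / q) = p); last by field.
rewrite mulrA ler_wpM2r ?powR_ge0//.
have nne : n%:R != 0 :> R by rewrite gt_eqF.
rewrite powRB ?nne ?implybT// powRr1 ?(ltW nR)//.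
by rewrite -powR_inv1 ?(ltW nR)// powRAC powR_inv1 ?powR_ge0.
Qed.

Lemma sum_mul_le_l2 (J : finType) (v v' : J -> R) (c c' : R) :
  0 <= c -> 0 <= c' -> \sum_j v j ^+ 2 <= c ^+ 2 ->
  \sum_j v' j ^+ 2 <= c' ^+ 2 -> \sum_j v j * v' j <= c * c'.
Proof.
have null (x : J -> R) : \sum_j x j ^+ 2 <= 0 ^+ 2 -> forall j, x j = 0.
  move=> x0 j; apply/eqP; rewrite -sqrf_eq0 eq_le sqr_ge0 andbT.
  rewrite expr0n in x0; apply: le_trans x0.
  by rewrite (bigD1 j)//= lerDl sumr_ge0// => i _; exact: sqr_ge0.
rewrite le0r => /predU1P[-> _ /null v0 _|c0].
  by rewrite big1 ?mul0r// => j _; rewrite v0 mul0r.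
rewrite le0r => /predU1P[-> _ /null v0|c'0 vc v'c'].
  by rewrite big1 ?mulr0// => j _; rewrite v0 mulr0.
have cc : 0 < 2 * (c * c') by rewrite !mulr_gt0.
rewrite -(ler_pM2l cc) mulr_sumr.
apply: (@le_trans _ _ (c' ^+ 2 * \sum_j v j ^+ 2 + c ^+ 2 * \sum_j v' j ^+ 2)).
  rewrite !mulr_sumr -big_split/=; apply: ler_sum => j _.
  by have := sqr_ge0 (c' * v j - c * v' j); lra.
have := ler_wpM2l (sqr_ge0 c') vc; have := ler_wpM2l (sqr_ge0 c) v'c'.
by lra.
Qed.

(** The triangle inequality in l_2 for a nonnegative combination of vectors: the
    form in which L_1 has cotype 2. *)
Lemma l2_sum_minkowski (J K : finType) (w : K -> R) (v : J -> K -> R) (c : K -> R) :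
  (forall k, 0 <= w k) -> (forall k, 0 <= c k) ->
  (forall k, \sum_j v j k ^+ 2 <= c k ^+ 2) ->
  \sum_j (\sum_k w k * v j k) ^+ 2 <= (\sum_k w k * c k) ^+ 2.
Proof.
move=> w0 c0 vc.
have sqr (x : K -> R) : (\sum_k w k * x k) ^+ 2 =
    \sum_k \sum_k' w k * w k' * (x k * x k').
  rewrite expr2 mulr_suml; apply: eq_bigr => k _.
  by rewrite mulr_sumr; apply: eq_bigr => k' _; ring.
rewrite sqr; under eq_bigr do rewrite sqr.
rewrite exchange_big/=; apply: ler_sum => k _.
rewrite exchange_big/=; apply: ler_sum => k' _.
by rewrite -mulr_sumr ler_wpM2l ?mulr_ge0// sum_mul_le_l2.
Qed.

End power_means.

Section means.
Variables (R : realType) (I : finType).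
Implicit Types F G : I -> R.

Lemma meanD F G : mean (fun i => F i + G i) = mean F + mean G.
Proof. by rewrite /mean big_split mulrDl. Qed.

Lemma meanZ (c : R) F : mean (fun i => c * F i) = c * mean F.
Proof. by rewrite /mean -mulr_sumr mulrA. Qed.

Lemma mean_sum (J : finType) (F : J -> I -> R) :
  mean (fun i => \sum_j F j i) = \sum_j mean (F j).
Proof. by rewrite /mean exchange_big mulr_suml. Qed.

Lemma mean_cst (c : R) : (0 < #|I|)%N -> mean (fun _ : I => c) = c.
Proof.
by move=> I0; rewrite /mean sumr_const -[c *+ _]mulr_natr mulfK// pnatr_eq0 -lt0n.
Qed.

Lemma mean_ge0 F : (forall i, 0 <= F i) -> 0 <= mean F.
Proof. by move=> F0; rewrite divr_ge0// sumr_ge0. Qed.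

Lemma ler_mean F G : (forall i, F i <= G i) -> mean F <= mean G.
Proof. by move=> FG; rewrite ler_wpM2r ?invr_ge0// ler_sum. Qed.

Lemma eq_mean F G : F =1 G -> mean F = mean G.
Proof. by move=> FG; rewrite /mean (eq_bigr G). Qed.

Lemma mean_reindex F (s : I -> I) : injective s -> mean (F \o s) = mean F.
Proof. by move=> s_inj; rewrite /mean [in RHS](reindex_inj s_inj). Qed.

Lemma powR_mean p F : (0 < #|I|)%N -> 1 <= p -> (forall i, 0 <= F i) ->
  mean F `^ p <= mean (fun i => F i `^ p).
Proof.
move=> I0 p1 F0; have jen := @powR_jensen R I p (fun=> #|I|%:R^-1) F p1.
have {}jen := jen (fun=> ltac:(by [])) _ F0.
have cst1 : \sum_(i : I) #|I|%:R^-1 = 1 :> R.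
  by rewrite sumr_const -[LHS]mulr_natr mulVf// pnatr_eq0 -lt0n.
by move: (jen cst1); rewrite -!mulr_sumr /mean ![_ / _]mulrC.
Qed.

End means.

(** * Finite L_1 metrics as cut metrics *)

Section cuts.
Variables (R : realType) (X : finType).
Implicit Types (S : {set X}) (x y z : X) (F : X -> R).

Definition cut_ind S x : R := (x \in S)%:R.

Definition cut_dist (w : {set X} -> R) x y : R :=
  \sum_S w S * `|cut_ind S x - cut_ind S y|.

Lemma cut_ind01 S x : cut_ind S x = 0 \/ cut_ind S x = 1.
Proof. by rewrite /cut_ind; case: (_ \in _); [right|left]. Qed.

Lemma cut_distC w x y : cut_dist w x y = cut_dist w y x.
Proof. by apply: eq_bigr => S _; rewrite distrC. Qed.

Lemma cut_dist_ge0 w x y : (forall S, 0 <= w S) -> 0 <= cut_dist w x y.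
Proof. by move=> w0; rewrite sumr_ge0// => S _; rewrite mulr_ge0. Qed.

Definition spread F : R := \sum_(q : X * X) `|F q.1 - F q.2|.

(** The length of the set of thresholds [u] with [S = {x | u <= F x}]: S contributes
    exactly when all its values lie above all values outside it. The minimum starts
    from [spread F], which dominates every difference of values, so that a set that
    separates two points gets its true gap. *)
Definition cut_gap F S : R := Num.max 0
  (\big[Num.min/spread F]_(q : X * X | (q.1 \in S) && (q.2 \notin S))
    (F q.1 - F q.2)).

Lemma le_spread F x y : `|F x - F y| <= spread F.
Proof. by rewrite /spread (bigD1 (x, y))//= lerDl sumr_ge0. Qed.

Lemma cut_gap_ge0 F S : 0 <= cut_gap F S.
Proof. by rewrite /cut_gap le_max lexx. Qed.

Lemma cut_gap_le_spread F S : cut_gap F S <= spread F.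
Proof. by rewrite /cut_gap ge_max bigmin_le_id andbT sumr_ge0. Qed.

Lemma cut_gap_le F S x y : x \in S -> y \notin S ->
  cut_gap F S <= Num.max 0 (F x - F y).
Proof.
move=> xS yS; rewrite /cut_gap ge_max !le_max lexx/=; apply/orP; right.
by apply: (bigmin_inf (x, y)) => //=; apply/andP.
Qed.

Lemma cut_gap_gt0 F S x y : 0 < cut_gap F S -> x \in S -> y \notin S -> F y < F x.
Proof.
move=> gap0 xS yS; have := lt_le_trans gap0 (cut_gap_le F xS yS).
by rewrite lt_max ltxx/= subr_gt0.
Qed.

(** When no value of F lies strictly between [F y] and [F x], the only superlevel
    set that separates x from y carries the whole difference. *)
Lemma cut_gap_upper F x y : F y < F x ->
  (forall z, F y < F z -> F x <= F z) -> cut_gap F [set z | F x <= F z] = F x - F y.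
Proof.
move=> yx nobetween; apply/eqP; rewrite eq_le; apply/andP; split.
  have := @cut_gap_le F [set z | F x <= F z] x y; rewrite !inE lexx -ltNge.
  by move=> /(_ isT yx); rewrite max_r// subr_ge0 ltW.
rewrite /cut_gap le_max; apply/orP; right; apply/bigmin_geP; split.
  by apply: le_trans (le_spread F x y); exact: ler_norm.
move=> [z t] /=; rewrite !inE -ltNge => /andP[xz tx]; rewrite lerB//.
by rewrite leNgt; apply: contraTN tx => /nobetween; rewrite leNgt.
Qed.

(** Cuts with positive gap are superlevel sets, so their indicators are monotone in
    F, and the cut metric is additive along the values of F, like the distance on a
    line. *)
Lemma cut_dist_between F x y z : F y <= F z -> F z <= F x ->
  cut_dist (cut_gap F) x y = cut_dist (cut_gap F) x z + cut_dist (cut_gap F) z y.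
Proof.
move=> yz zx; rewrite /cut_dist -big_split/=; apply: eq_bigr => S _.
rewrite -mulrDr; have := cut_gap_ge0 F S; rewrite le0r => /predU1P[->|gap0].
  by rewrite !mul0r.
congr (_ * _); have up s t : F s <= F t -> s \in S -> t \in S.
  move=> st sS; apply: contraTT st => tS; rewrite -ltNge.
  exact: cut_gap_gt0 gap0 sS tS.
rewrite /cut_ind; move: (up _ _ zx) (up _ _ yz).
case: (x \in S); case: (y \in S); case: (z \in S) => // xz yz';
  rewrite ?(subrr, subr0, normr0, normr1, addr0, add0r)//.
all: by [have := xz isT|have := yz' isT].
Qed.

(** The layer-cake formula for |F x - F y|. By additivity it reduces to consecutive
    values of F; the induction is on the number of points with value in
    ]F y, F x]. *)
Lemma cut_dist_gap F x y : cut_dist (cut_gap F) x y = `|F x - F y|.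
Proof.
wlog yx : x y / F y <= F x.
  by case: (leP (F y) (F x)) => [yx|/ltW xy] wl; [|rewrite cut_distC distrC]; exact: wl.
rewrite ger0_norm ?subr_ge0//.
have [N] := ubnP #|[set z | F y < F z <= F x]|.
elim: N x y yx => // N IHN x y yx; rewrite ltnS => cardN.
move: (yx); rewrite le_eqVlt => /predU1P[yxE|yltx].
  rewrite yxE subrr /cut_dist big1// => S _.
  have gap0 s t : s \in S -> t \notin S -> F s = F t -> cut_gap F S = 0.
    move=> sS tS st; apply/eqP; rewrite eq_le cut_gap_ge0 andbT.
    by have := cut_gap_le F sS tS; rewrite st subrr maxxx.
  rewrite /cut_ind; case: (boolP (x \in S)) => xS; case: (boolP (y \in S)) => yS;
    rewrite ?subrr ?normr0 ?mulr0//.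
  - by rewrite (gap0 _ _ xS yS) ?mul0r.
  - by rewrite (gap0 _ _ yS xS) ?mul0r.
have [/existsP[z /andP[yz zx]]|/existsPn nobetween] :=
    boolP [exists z, (F y < F z) && (F z < F x)].
  rewrite (cut_dist_between (ltW yz) (ltW zx)) !IHN ?(ltW yz) ?(ltW zx)//.
  - by rewrite subrKA.
  - apply: leq_trans cardN; apply: proper_card; apply/properP; split.
      apply/fintype.subsetP => t; rewrite !inE => /andP[-> /le_trans]; apply.
      exact: ltW.
    by exists x; rewrite !inE ?yltx ?lexx// negb_and -ltNge zx orbT.
  - apply: leq_trans cardN; apply: proper_card; apply/properP; split.
      apply/fintype.subsetP => t; rewrite !inE =>  /andP[zt ->].
      by rewrite (lt_trans yz).
    by exists z; rewrite !inE ?yz ?(ltW zx)// ltxx.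
have {}nobetween z : F y < F z -> F x <= F z.
  by move=> yz; have := nobetween z; rewrite yz/= -leNgt.
rewrite /cut_dist (bigD1 [set z | F x <= F z])//= (cut_gap_upper yltx)//.
rewrite /cut_ind !inE lexx leNgt yltx/= subr0 normr1 mulr1 big1 ?addr0// => S SE.
have := cut_gap_ge0 F S; rewrite le0r => /predU1P[->|gap0]; first by rewrite mul0r.
case: (boolP (x \in S)) => xS; case: (boolP (y \in S)) => yS;
  rewrite ?subrr ?normr0 ?mulr0//.
  case/eqP: SE; apply/setP => z; rewrite !inE.
  case: (boolP (z \in S)) => zS; apply/esym.
    by apply: nobetween; exact: cut_gap_gt0 gap0 zS yS.
  by apply/negbTE; rewrite -ltNge; exact: cut_gap_gt0 gap0 xS zS.
by have := cut_gap_gt0 gap0 yS xS; rewrite ltNge yx.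
Qed.

End cuts.


Section L1_cuts.
Context d (T : measurableType d) (R : realType) (mu : {measure set T -> \bar R}).

Lemma measurable_bigmin (I : Type) (r : seq I) (P : pred I) (b : T -> R)
    (f : I -> T -> R) :
  measurable_fun setT b -> (forall i, measurable_fun setT (f i)) ->
  measurable_fun setT (fun t => \big[Num.min/b t]_(i <- r | P i) f i t).
Proof.
move=> mb mf; elim: r => [|i r IHr].
  by under eq_fun do rewrite big_nil.
under eq_fun do rewrite big_cons; case: (P i) => //.
exact: measurable_minr.
Qed.

(** The layer-cake formula integrated over [T]. A gap is measurable in the parameter
    as a finite minimum of differences, and integrable since [spread] bounds it. *)
Lemma L1_cut_dist (X : finType) (F : X -> T -> R) :
  (forall x, measurable_fun setT (F x)) ->
  (forall x y, \int[mu]_t `|(F x t - F y t)%:E| < +oo)%E ->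
  exists2 w : {set X} -> R, (forall S, 0 <= w S) &
    forall x y, fine (\int[mu]_t `|(F x t - F y t)%:E|)%E = cut_dist w x y.
Proof.
move=> mF intF; pose gap S t : R := cut_gap (F^~ t) S.
have mB x y : measurable_fun setT (fun t => F x t - F y t).
  exact: measurable_funB.
have mN x y : measurable_fun setT (fun t => `|F x t - F y t|).
  exact: measurableT_comp.
have mspread : measurable_fun setT (fun t => spread (F^~ t)).
  by apply: measurable_sum => q; exact: mN.
have mgap S : measurable_fun setT (gap S).
  apply: measurable_maxr; first exact: measurable_cst.
  by apply: measurable_bigmin => // q; exact: mB.
have mgapE S : measurable_fun setT (fun t => (gap S t)%:E).
  exact/measurable_EFinP.
have gap0 S t : (0 <= (gap S t)%:E)%E by rewrite lee_fin cut_gap_ge0.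
have gap_fin S : (\int[mu]_t (gap S t)%:E)%E \is a fin_num.
  rewrite ge0_fin_numE ?integral_ge0//.
  apply: (@le_lt_trans _ _ (\int[mu]_t (spread (F^~ t))%:E)%E).
    apply: ge0_le_integral => //.
    - exact/measurable_EFinP.
    - by move=> t _; rewrite lee_fin cut_gap_le_spread.
  under eq_integral do rewrite -sumEFin.
  rewrite ge0_integral_sum//.
    by apply: lte_sum_pinfty => -[x y] _; exact: intF.
  by move=> [x y]; apply/measurable_EFinP; exact: mN.
exists (fun S => fine (\int[mu]_t (gap S t)%:E)%E) => [S|x y].
  by rewrite fine_ge0// integral_ge0.
have -> : (\int[mu]_t `|(F x t - F y t)%:E|)%E = (cut_dist
    (fun S => fine (\int[mu]_t (gap S t)%:E)%E) x y)%:E.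
  rewrite /cut_dist -sumEFin.
  transitivity (\int[mu]_t \sum_S
      (`|cut_ind R S x - cut_ind R S y|%:E * (gap S t)%:E))%E.
    apply: eq_integral => t _; rewrite abse_EFin -(cut_dist_gap (F^~ t)).
    by rewrite /cut_dist -sumEFin; apply: eq_bigr => S _; rewrite -EFinM mulrC.
  rewrite ge0_integral_sum//.
  - apply: eq_bigr => S _; rewrite ge0_integralZl_EFin// EFinM fineK// muleC.
    by [].
  - by move=> S; apply: measurable_funeM.
  - by move=> S t _; rewrite mule_ge0.
by [].
Qed.

End L1_cuts.

Section hexagonal_norm.
Variable R : realType.
Local Open Scope complex_scope.

(** S is the sum of the absolute values of the projections of z onto three lines at
    angles of 60 degrees, with s = sqrt 3. The last two sum to the maximum of |Re z|
    and s |Im z|, so S is the larger of 2 |Re z| and |Re z| + s |Im z|. *)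
Lemma hexagonal_normc (z : R[i]) (s : R) : 0 <= s -> s ^+ 2 = 3 ->
  let S := `|complex.Re z| + (`|complex.Re z / 2 + s / 2 * complex.Im z| +
                              `|complex.Re z / 2 - s / 2 * complex.Im z|) in
  s * normc z <= S /\ S <= 2 * normc z.
Proof.
move=> s0 s2 S; have r0 := Defs.normc_ge0 z.
have r2 : normc z ^+ 2 = complex.Re z ^+ 2 + complex.Im z ^+ 2.
  by rewrite Defs.normcE sqr_sqrtr// addr_ge0 ?sqr_ge0.
move: (normc z) r0 r2 @S => r r0; case: z => a b /=.
rewrite -(real_normK (num_real a)) -(real_normK (num_real b)).
set A := `|a|; set B := `|b|; set u := a / 2 + _; set v := a / 2 - _ => r2.
have A0 : 0 <= A by exact: normr_ge0.
have B0 : 0 <= B by exact: normr_ge0.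
have uvA : A <= `|u| + `|v|.
  by apply: le_trans (ler_normD u v); rewrite le_eqVlt /u /v /A addrACA subrr addr0
    -splitr eqxx.
have uvB : s * B <= `|u| + `|v|.
  apply: le_trans (ler_normB u v); rewrite le_eqVlt /B -{1}(ger0_norm s0) -normrM.
  by apply/orP; left; apply/eqP; congr `|_|; rewrite /u /v; field.
have uv_max : `|u| + `|v| <= A \/ `|u| + `|v| <= s * B.
  have ha := ler_norm a; have ha' : - a <= A by rewrite /A -normrN ler_norm.
  have hb : s * b <= s * B by rewrite ler_wpM2l// ler_norm.
  have hb' : s * - b <= s * B by rewrite ler_wpM2l// /B -normrN ler_norm.
  rewrite -/A in ha.
  case: (ger0P u) => u0; case: (ger0P v) => v0.
  - by left; rewrite /u /v; lra.
  - by right; rewrite /u /v; lra.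
  - by right; rewrite /u /v; lra.
  - by left; rewrite /u /v; lra.
have S0 : 0 <= A + (`|u| + `|v|) by rewrite !addr_ge0.
have sB0 : 0 <= s * B by exact: mulr_ge0.
have sB2 : (s * B) ^+ 2 = 3 * B ^+ 2 by rewrite exprMn s2.
move: (`|u| + `|v|) uvA uvB uv_max S0 => U UA UB U_max S0.
have U0 := le_trans A0 UA.
split.
  rewrite -(ler_pXn2r (n := 2)) ?nnegrE ?mulr_ge0// exprMn s2 r2.
  have [AB|BA] := leP A (s * B).
    have := mulr_ge0 A0 (_ : 0 <= s * B - A); rewrite subr_ge0 => /(_ AB) h.
    apply: (@le_trans _ _ ((A + s * B) ^+ 2)).
      by rewrite sqrrD sB2; lra.
    by apply: lerXn2r; rewrite ?nnegrE ?addr_ge0 ?lerD2l.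
  apply: (@le_trans _ _ ((2 * A) ^+ 2)).
    have : (s * B) ^+ 2 <= A ^+ 2 by apply: lerXn2r; rewrite ?nnegrE// ltW.
    by rewrite sB2 exprMn; lra.
  by apply: lerXn2r; rewrite ?nnegrE ?mulr_ge0//; lra.
have Ar : A <= r.
  rewrite -(ler_pXn2r (n := 2)) ?nnegrE// r2 lerDl sqr_ge0//.
case: U_max => hU; first by lra.
apply: (@le_trans _ _ (A + s * B)); first by rewrite lerD2l.
rewrite -(ler_pXn2r (n := 2)) ?nnegrE ?addr_ge0 ?mulr_ge0// exprMn r2.
have := sqr_ge0 (s * A - B); rewrite sqrrB exprMn s2 sqrrD sB2; lra.
Qed.

End hexagonal_norm.


Section L1_representation.
Context d (T : measurableType d) (R : realType) (mu : {measure set T -> \bar R}).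
Variable X : finType.
Local Open Scope complex_scope.

Lemma real_L1_cuts (f : X -> LspaceType1 mu) :
  exists2 w : {set X} -> R, (forall S, 0 <= w S) &
    forall x y, mdist (f x) (f y) = cut_dist w x y.
Proof.
have mf x : measurable_fun setT (f x : T -> R) by exact: L1_measurable.
have distE x y : (\int[mu]_t `|(f x t - f y t)%:E|)%E = (mdist (f x) (f y))%:E.
  by rewrite -Lnorm1; exact/esym/L1_distE.
have fin x y : (\int[mu]_t `|(f x t - f y t)%:E| < +oo)%E.
  by rewrite distE ltry.
have [w w0 wE] := L1_cut_dist mf fin.
by exists w => // x y; rewrite -wE distE.
Qed.

Lemma complex_L1_cuts (f : X -> complexL1 mu) :
  exists2 w : {set X} -> R, (forall S, 0 <= w S) & forall x y,
    Num.sqrt 3 * mdist (f x) (f y) <= cut_dist w x y /\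
    cut_dist w x y <= 2 * mdist (f x) (f y).
Proof.
have [s [sE s0 s2]] : exists s : R, [/\ s = Num.sqrt 3, 0 <= s & s ^+ 2 = 3].
  by exists (Num.sqrt 3); rewrite sqrtr_ge0 sqr_sqrtr.
rewrite -sE.
pose l0 (z : R[i]) := complex.Re z.
pose l1 (z : R[i]) := complex.Re z / 2 + s / 2 * complex.Im z.
pose l2 (z : R[i]) := complex.Re z / 2 - s / 2 * complex.Im z.
have hex x y t : s * normc (sval (f x) t - sval (f y) t) <=
    `|l0 (sval (f x) t) - l0 (sval (f y) t)| +
    (`|l1 (sval (f x) t) - l1 (sval (f y) t)| +
     `|l2 (sval (f x) t) - l2 (sval (f y) t)|) /\
    `|l0 (sval (f x) t) - l0 (sval (f y) t)| +
    (`|l1 (sval (f x) t) - l1 (sval (f y) t)| +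
     `|l2 (sval (f x) t) - l2 (sval (f y) t)|) <=
    2 * normc (sval (f x) t - sval (f y) t).
  have := hexagonal_normc (sval (f x) t - sval (f y) t) s0 s2.
  case: (sval (f x) t) (sval (f y) t) => [xa xb] [ya yb] /=.
  rewrite /l0 /l1 /l2 /=.
  have -> : xa / 2 + s / 2 * xb - (ya / 2 + s / 2 * yb) =
    (xa - ya) / 2 + s / 2 * (xb - yb) by field.
  have -> : xa / 2 - s / 2 * xb - (ya / 2 - s / 2 * yb) =
    (xa - ya) / 2 - s / 2 * (xb - yb) by field.
  by [].
have mf x : measurable_fun setT (sval (f x) : T -> R[i]) by exact: complexL1_measurable.
have mRe x : measurable_fun setT (fun t => complex.Re (sval (f x) t)).
  by apply: measurableT_comp; [exact: measurable_Re|exact: mf].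
have mIm x : measurable_fun setT (fun t => complex.Im (sval (f x) t)).
  by apply: measurableT_comp; [exact: measurable_Im|exact: mf].
have distE x y : (\int[mu]_t (normc (sval (f x) t - sval (f y) t))%:E)%E =
    (mdist (f x) (f y))%:E.
  transitivity ('N[mu]_1[(fun t => (normc (sval (f x) t - sval (f y) t))%:E)])%E.
    rewrite Lnorm1; apply: eq_integral => t _.
    by rewrite abse_EFin ger0_norm// Defs.normc_ge0.
  exact/esym/complexL1_distE.
have mdistf x y : measurable_fun setT
    (fun t => (normc (sval (f x) t - sval (f y) t))%:E).
  by apply/measurable_EFinP; exact: complexL1_measurableB.
have ml (l : R[i] -> R) : (forall x, measurable_fun setT (fun t => l (sval (f x) t))) ->
    forall x y, measurable_fun setT
      (fun t => `|(l (sval (f x) t) - l (sval (f y) t))%:E|%E).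
  move=> mlf x y; do 2 apply: measurableT_comp => //.
  exact: measurable_funB.
have cuts (l : R[i] -> R) : (forall x, measurable_fun setT (fun t => l (sval (f x) t))) ->
    (forall x y t, `|l (sval (f x) t) - l (sval (f y) t)| <=
      2 * normc (sval (f x) t - sval (f y) t)) ->
    exists2 w : {set X} -> R, (forall S, 0 <= w S) & forall x y,
      (\int[mu]_t `|(l (sval (f x) t) - l (sval (f y) t))%:E|)%E =
        (cut_dist w x y)%:E.
  move=> mlf lle.
  have fin x y :
      (\int[mu]_t `|(l (sval (f x) t) - l (sval (f y) t))%:E| < +oo)%E.
    apply: (@le_lt_trans _ _ (2%:E *
        \int[mu]_t (normc (sval (f x) t - sval (f y) t))%:E)%E); last first.
      by rewrite distE -EFinM ltry.
    rewrite -ge0_integralZl_EFin//; last first.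
      by move=> t _; rewrite lee_fin Defs.normc_ge0.
    apply: ge0_le_integral => //.
    - exact: ml.
    - exact: measurable_funeM.
    - by move=> t _; rewrite abse_EFin -EFinM lee_fin.
  have [w w0 wE] := L1_cut_dist mlf fin.
  exists w => // x y; rewrite -wE fineK// ge0_fin_numE ?integral_ge0//.
have [||w0 w0_ge0 w0E] := cuts l0.
- exact: mRe.
- move=> x y t; have [_] := hex x y t; apply: le_trans.
  by rewrite lerDl addr_ge0.
have ml1 x : measurable_fun setT (fun t => l1 (sval (f x) t)).
  by apply: measurable_funD; apply: measurable_funM.
have ml2 x : measurable_fun setT (fun t => l2 (sval (f x) t)).
  by apply: measurable_funB; apply: measurable_funM.
have [||w1 w1_ge0 w1E] := cuts l1 => //.
- move=> x y t; have [_] := hex x y t; apply: le_trans.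
  by rewrite addrCA lerDl addr_ge0.
have [||w2 w2_ge0 w2E] := cuts l2 => //.
- move=> x y t; have [_] := hex x y t; apply: le_trans.
  by rewrite addrA lerDr addr_ge0.
exists (fun S => w0 S + (w1 S + w2 S)) => [S|x y]; first by rewrite !addr_ge0.
have -> : cut_dist (fun S => w0 S + (w1 S + w2 S)) x y =
    cut_dist w0 x y + (cut_dist w1 x y + cut_dist w2 x y).
  by rewrite /cut_dist -!big_split; apply: eq_bigr => S _ /=; rewrite !mulrDl.
rewrite -!lee_fin !EFinM !EFinD -w0E -w1E -w2E -distE.
have ml0 := ml l0 mRe x y; have {}ml1 := ml l1 ml1 x y; have {}ml2 := ml l2 ml2 x y.
rewrite -[X in (_ + X)%E]ge0_integralD// -ge0_integralD//; last 2 first.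
- by move=> t _; exact: adde_ge0.
- exact: emeasurable_funD.
have nc0 t : setT t -> (0 <= (normc (sval (f x) t - sval (f y) t))%:E)%E.
  by move=> _; rewrite lee_fin Defs.normc_ge0.
have mhex := emeasurable_funD ml0 (emeasurable_funD ml1 ml2).
rewrite -!ge0_integralZl_EFin//; split; apply: ge0_le_integral => //.
- by move=> t _; rewrite -EFinM lee_fin mulr_ge0// Defs.normc_ge0.
- exact: measurable_funeM.
- by move=> t _; rewrite !abse_EFin -!EFinD -EFinM lee_fin; exact: (hex x y t).1.
- by move=> t _; rewrite !abse_EFin -!EFinD lee_fin !addr_ge0.
- exact: measurable_funeM.
- by move=> t _; rewrite !abse_EFin -!EFinD -EFinM lee_fin; exact: (hex x y t).2.
Qed.

End L1_representation.

(** * Harmonic analysis on the sign cube *)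

Section ternary_cube.
Variables (R : realType) (n : nat).
Local Notation cube := {ffun 'I_n -> 'I_3}.
Implicit Types (e : cube) (j : 'I_n) (s : 'I_3).

Definition update e j s : cube := [ffun i => if i == j then s else e i].

Lemma cube_gt0 : (0 < #|{: cube}|)%N.
Proof. by apply/card_gt0P; exists [ffun=> ord0]. Qed.

(** Shifting the j-th coordinate by a constant of the group Z/3 is a bijection of
    the cube; averaging over the three shifts resamples that coordinate. *)
Lemma mean_update (h : cube -> R) j :
  mean h = (\sum_s mean (fun e => h (update e j s))) / 3.
Proof.
rewrite -mean_sum; apply: canRL (mulfK _) _; first by rewrite pnatr_eq0.
have shift (k : 'I_3) : mean (fun e => h (update e j (e j + k))) = mean h.
  apply: (@mean_reindex R _ h (fun e => update e j (e j + k))) => e e' /ffunP ee'.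
  apply/ffunP => i; have := ee' i; rewrite !ffunE; case: eqP => // -> .
  exact: addIr.
transitivity (\sum_(k : 'I_3) mean (fun e => h (update e j (e j + k)))).
  by rewrite (eq_bigr _ (fun k _ => shift k)) sumr_const card_ord mulr_natr.
rewrite -mean_sum; apply: eq_mean => e.
by rewrite [RHS](reindex_inj (addrI (e j))).
Qed.

Lemma mean_update_le (h : cube -> R) j s : (forall e, 0 <= h e) ->
  mean (fun e => h (update e j s)) <= 3 * mean h.
Proof.
move=> h0; rewrite (mean_update h j) mulrC divfK ?pnatr_eq0// (bigD1 s)//=.
by rewrite lerDl sumr_ge0// => t _; exact: mean_ge0.
Qed.

(** The entries 0, 1, 2 encode the signs -1, 0, 1. *)
Definition sgn3 s : R := (s : nat)%:R - 1.

Lemma update_id e j s : update e j s j = s.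
Proof. by rewrite ffunE eqxx. Qed.

Lemma mean_sgn3M (h : cube -> R) j :
  mean (fun e => h e * sgn3 (e j)) =
  (mean (fun e => h (update e j ord_max)) -
   mean (fun e => h (update e j ord0))) / 3.
Proof.
rewrite (mean_update _ j); congr (_ / _); rewrite !big_ord_recl big_ord0 addr0.
have -> : lift ord0 (lift ord0 ord0) = ord_max :> 'I_3 by exact: val_inj.
have sgnE s : mean (fun e => h (update e j s) * sgn3 (update e j s j)) =
    sgn3 s * mean (fun e => h (update e j s)).
  by rewrite -meanZ; apply: eq_mean => e; rewrite update_id mulrC.
rewrite !sgnE.
have -> : sgn3 ord0 = -1 by rewrite /sgn3 sub0r.
have -> : sgn3 (lift ord0 ord0) = 0 by rewrite /sgn3 subrr.
have -> : sgn3 ord_max = 1 by rewrite /sgn3 /= mulr2n addrK.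
by rewrite mulN1r mul0r mul1r add0r addrC.
Qed.

Lemma mean_sgn3_sgn3 i j :
  mean (fun e => sgn3 (e i) * sgn3 (e j)) = if i == j then 2 / 3 else 0.
Proof.
rewrite (mean_sgn3M (fun e => sgn3 (e i))); case: eqP => [->|/eqP ij].
  have upd s : mean (fun e => sgn3 (update e j s j)) = sgn3 s.
    by under eq_mean do rewrite update_id; rewrite mean_cst ?cube_gt0.
  by rewrite !upd; congr (_ / _); rewrite /sgn3/=; lra.
have upd s : mean (fun e => sgn3 (update e j s i)) = mean (fun e => sgn3 (e i)).
  by apply: eq_mean => e; rewrite ffunE (negPf ij).
by rewrite !upd subrr mul0r.
Qed.

Lemma mean_sgn3 j : mean (fun e => sgn3 (e j)) = 0.
Proof.
transitivity (mean (fun e => 1 * sgn3 (e j))).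
  by apply: eq_mean => e; rewrite mul1r.
by rewrite (mean_sgn3M (fun=> 1)) !mean_cst ?cube_gt0// subrr mul0r.
Qed.

(** Bessel's inequality for the orthogonal family of the coordinate signs, each of
    mean square 2/3. With b_j half the increment of the conditional mean of h in
    direction j, the correlation of h with the j-th sign is (2/3) b_j, and the
    variance of h is mean h * (1 - mean h) because h takes its values in {0, 1}. *)
Lemma level1_inequality (h : cube -> R) : (forall e, h e ^+ 2 = h e) ->
  \sum_j ((mean (fun e => h (update e j ord_max)) -
           mean (fun e => h (update e j ord0))) / 2) ^+ 2
  <= 3 / 2 * (mean h * (1 - mean h)).
Proof.
move=> h2; set a := mean h.
pose b j : R := (mean (fun e => h (update e j ord_max)) -
                 mean (fun e => h (update e j ord0))) / 2.
rewrite -/(\sum_j b j ^+ 2); set B := \sum_j _.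
pose T e := \sum_j b j * sgn3 (e j).
have mT : mean T = 0.
  by rewrite mean_sum big1// => j _; rewrite meanZ mean_sgn3 mulr0.
have mhT : mean (fun e => h e * T e) = 2 / 3 * B.
  rewrite (eq_mean (G := fun e => \sum_j b j * (h e * sgn3 (e j)))); last first.
    by move=> e; rewrite mulr_sumr; apply: eq_bigr => j _; rewrite mulrCA.
  rewrite mean_sum mulr_sumr; apply: eq_bigr => j _; rewrite meanZ mean_sgn3M.
  by rewrite /b; field.
have mTT : mean (fun e => T e * T e) = 2 / 3 * B.
  rewrite (eq_mean (G := fun e => \sum_i \sum_j
      b i * b j * (sgn3 (e i) * sgn3 (e j)))); last first.
    move=> e; rewrite mulr_suml; apply: eq_bigr => i _.
    by rewrite mulr_sumr; apply: eq_bigr => j _; ring.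
  rewrite mean_sum mulr_sumr; apply: eq_bigr => i _.
  rewrite mean_sum (bigD1 i)//= big1 ?addr0 => [|j ji].
    by rewrite meanZ mean_sgn3_sgn3 eqxx; ring.
  by rewrite meanZ mean_sgn3_sgn3 eq_sym (negPf ji) mulr0.
(* T is the projection of h - a onto the span of the signs; this is
   Bessel's defect. *)
have : 0 <= mean (fun e => (h e - a - T e) ^+ 2).
  by apply: mean_ge0 => e; exact: sqr_ge0.
rewrite (eq_mean (G := fun e => (1 - 2 * a) * h e + (a ^+ 2 +
    (T e * T e + (- 2 * (h e * T e) + 2 * a * T e))))); last first.
  move=> e; have -> : (h e - a - T e) ^+ 2 = h e ^+ 2 - 2 * a * h e +
      (a ^+ 2 + (T e * T e + (- 2 * (h e * T e) + 2 * a * T e))) by ring.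
  by rewrite h2; ring.
rewrite !meanD (mean_cst (a ^+ 2)) ?cube_gt0// !meanZ mT mhT mTT -/a.
lra.
Qed.

End ternary_cube.


Section median_polynomial.
Variable R : realType.
Implicit Types a x y z : R.

(** The probability that at least two of three independent events of probability
    [a] occur. *)
Definition med3 a : R := 3 * a ^+ 2 - 2 * a ^+ 3.

(** The defect is [2 a (a - 3/4)^2]. *)
Lemma med3_le a : 0 <= a -> med3 a <= 9 / 8 * a.
Proof.
move=> a0; rewrite /med3; have := mulr_ge0 a0 (sqr_ge0 (a - 3 / 4)).
lra.
Qed.

Lemma med3_ge0 a : 0 <= a <= 1 -> 0 <= med3 a.
Proof.
move=> /andP[a0 a1]; have -> : med3 a = a ^+ 2 * (3 - 2 * a) by rewrite /med3; ring.
by rewrite mulr_ge0 ?sqr_ge0//; lra.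
Qed.

Lemma med3C a : 1 - med3 a = med3 (1 - a).
Proof. by rewrite /med3; ring. Qed.

(** The slope of [med3] is of order a(1 - a). With [c = (x + y) / 2] the difference
    quotient is at most [6 c (1 - c)], and concavity of [t (1 - t)] compares the
    midpoint c with the mean [(2 c + z) / 3] of the three values. *)
Lemma sqr_med3B x y z : 0 <= x <= 1 -> 0 <= y <= 1 -> 0 <= z <= 1 ->
  (med3 y - med3 x) ^+ 2 <=
  324 * (((x + y + z) / 3) * (1 - (x + y + z) / 3)) ^+ 2 * ((y - x) / 2) ^+ 2.
Proof.
move=> /andP[x0 x1] /andP[y0 y1] /andP[z0 z1].
set K := _ * (1 - _).
set P := 3 * (x + y) - 2 * (x ^+ 2 + x * y + y ^+ 2).
have -> : med3 y - med3 x = P * (y - x) by rewrite /med3 /P; ring.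
have P0 : 0 <= P.
  have := mulr_ge0 x0 (_ : 0 <= 1 - x); have := mulr_ge0 y0 (_ : 0 <= 1 - y).
  have := mulr_ge0 x0 (_ : 0 <= 1 - y); have := mulr_ge0 y0 (_ : 0 <= 1 - x).
  rewrite !subr_ge0 => /(_ x1) + /(_ y1) + /(_ y1) + /(_ x1).
  rewrite /P; lra.
have PK : P <= 9 * K.
  have := mulr_ge0 z0 (_ : 0 <= 1 - z); rewrite subr_ge0 => /(_ z1).
  have := sqr_ge0 ((x + y) / 2 - z); have := sqr_ge0 (x - y).
  rewrite /P /K; lra.
have -> : 324 * K ^+ 2 * ((y - x) / 2) ^+ 2 = (9 * K) ^+ 2 * (y - x) ^+ 2 by field.
rewrite exprMn ler_wpM2r ?sqr_ge0// ler_pXn2r// nnegrE//.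
exact: le_trans PK.
Qed.

End median_polynomial.
(** * Majority smoothing of cuts *)

Section cut_metrics.
Variables (R : realType) (m n : nat).
Local Notation G := 'rV['Z_m]_n.
Local Notation cube := {ffun 'I_n -> 'I_3}.
Implicit Types (S : {set G}) (x y z : G) (j : 'I_n) (s : 'I_3) (w : {set G} -> R).

Definition mid3 : 'I_3 := lift ord0 ord0.

Definition local_density S j s x : R :=
  mean (fun e => cut_ind R S (x + sign_vector m (update e j s))).

Definition smoothing S j x : R := med3 (local_density S j mid3 x).

Lemma mean_cut_ind_itv (F : cube -> G) S : 0 <= mean (fun e => cut_ind R S (F e)) <= 1.
Proof.
rewrite mean_ge0 => [|e]; last by rewrite ler0n.
rewrite -[leRHS](@mean_cst R cube 1) ?cube_gt0// ler_mean// => e.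
by rewrite /cut_ind; case: (_ \in _).
Qed.

Lemma mean_cut_dist (F : cube -> G) w x :
  \sum_S w S * mean (fun e => `|cut_ind R S (F e) - cut_ind R S x|) =
  mean (fun e => cut_dist w (F e) x).
Proof. by rewrite mean_sum; apply: eq_bigr => S _; rewrite meanZ. Qed.

Lemma sign_vector_update e j s : sign_vector m (update e j s) =
  sign_vector m (update e j mid3) + delta_mx 0 j *~ ((s : nat)%:Z - 1).
Proof.
apply/rowP => i; rewrite !mxE !ffunE.
rewrite -scaler_int !mxE eqxx/=; case: eqVneq => _.
  by rewrite mulr1 subrr add0r.
by rewrite mulr0 addr0.
Qed.

(** Moving the centre by e_j is the same as changing the frozen sign, so a step of
    [smoothing] from x - e_j to x + e_j compares the densities around x with j-th
    sign frozen at -1 and at 1. *)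
Lemma local_density_shift S j x :
  local_density S j ord0 (x + delta_mx 0 j) = local_density S j mid3 x /\
  local_density S j mid3 (x + delta_mx 0 j) = local_density S j ord_max x.
Proof.
split; apply: eq_mean => e; congr (cut_ind R S _).
  by rewrite (sign_vector_update e j ord0) sub0r mulrN1z addrACA subrr addr0.
by rewrite (sign_vector_update e j ord_max) mulr1z addrAC addrA.
Qed.

(** If x is outside S then the density is the mean distance to S itself, and
    [med3 a <= 9/8 a]; the other case follows by exchanging S with its
    complement. *)
Lemma smoothing_error S j s x :
  `|med3 (local_density S j s x) - cut_ind R S x| <= 9 / 8 *
    mean (fun e => `|cut_ind R S (x + sign_vector m (update e j s)) - cut_ind R S x|).
Proof.
set F := fun e => x + sign_vector m (update e j s).
have := mean_cut_ind_itv F S; rewrite -/(local_density S j s x).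
set a := local_density S j s x => a01; have /andP[a0 a1] := a01.
have dist01 e : cut_ind R S (F e) = `|cut_ind R S (F e)| /\
    1 - cut_ind R S (F e) = `|cut_ind R S (F e) - 1|.
  by case: (cut_ind01 R S (F e)) => ->; rewrite ?subrr ?subr0 ?sub0r ?normrN !normr1 ?normr0.
case: (cut_ind01 R S x) => ->.
  rewrite subr0 ger0_norm ?med3_ge0//.
  under eq_mean do rewrite subr0 -(dist01 _).1.
  exact: med3_le.
have a01' : 0 <= 1 - a <= 1 by apply/andP; split; lra.
rewrite distrC med3C ger0_norm ?med3_ge0//.
under eq_mean do rewrite -(dist01 _).2.
have -> : mean (fun e => 1 - cut_ind R S (F e)) = 1 - a.
  under eq_mean do rewrite -mulN1r.
  by rewrite meanD mean_cst ?cube_gt0// meanZ mulN1r.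
by apply: med3_le; lra.
Qed.

(** The level-1 inequality bounds the sum of squares of the increments of the
    density by 3/2 K, the slope of [med3] contributes 324 K^2, and K <= 1/4 turns
    486 K^3 into 243/2 K^2, with (276/25)^2 just above 243/2. Finally K is at most
    a as well as 1 - a, and one of these is the mean on the right. *)
Lemma smoothing_gradient S x :
  \sum_j `|med3 (local_density S j ord_max x) -
           med3 (local_density S j ord0 x)| ^+ 2 <=
  (276 / 25 *
    mean (fun e => `|cut_ind R S (x + sign_vector m e) - cut_ind R S x|)) ^+ 2.
Proof.
set a := mean (fun e => cut_ind R S (x + sign_vector m e)).
have /andP[a0 a1] : 0 <= a <= 1 by exact: mean_cut_ind_itv.
have aE j : a = (local_density S j ord0 x + local_density S j ord_max x +
                 local_density S j mid3 x) / 3.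
  rewrite /a (mean_update _ j) !big_ord_recl big_ord0 addr0 -addrA.
  have -> : lift ord0 (lift ord0 ord0) = ord_max :> 'I_3 by exact: val_inj.
  by congr (_ / 3); congr (_ + _); rewrite addrC.
have lvl1 := @level1_inequality R n (fun e => cut_ind R S (x + sign_vector m e)).
have {}lvl1 := lvl1 (fun e => ltac:(by
  case: (cut_ind01 R S (x + sign_vector m e)) => ->; rewrite ?expr1n ?expr0n)).
set M := mean (fun e => `|_ - _|).
have KM : a * (1 - a) <= M.
  case: (cut_ind01 R S x) => xS.
    apply: (@le_trans _ _ a); first by rewrite ler_piMr// lerBlDr lerDl.
    by apply: ler_mean => e; rewrite xS subr0 ler_norm.
  apply: (@le_trans _ _ (1 - a)); first by rewrite ler_piMl// subr_ge0.
  have -> : 1 - a = mean (fun e => 1 - cut_ind R S (x + sign_vector m e)).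
    under eq_mean do rewrite -mulN1r.
    by rewrite meanD mean_cst ?cube_gt0// meanZ mulN1r.
  by apply: ler_mean => e; rewrite xS distrC ler_norm.
rewrite -/a in lvl1; clearbody a M.
have : exists2 K, K = a * (1 - a) & 0 <= K <= 1 / 4.
  exists (a * (1 - a)) => //; rewrite mulr_ge0 ?subr_ge0//=.
  by have := sqr_ge0 (a - 1 / 2); lra.
case=> K KE /andP[K0 K4]; rewrite -KE in lvl1 KM.
apply: (@le_trans _ _ (324 * K ^+ 2 * (3 / 2 * K))).
  have c0 : 0 <= 324 * K ^+ 2 by have := sqr_ge0 K; lra.
  apply: le_trans (ler_wpM2l c0 lvl1).
  rewrite mulr_sumr; apply: ler_sum => j _; rewrite real_normK ?num_real//.
  by rewrite KE (aE j); apply: sqr_med3B; exact: mean_cut_ind_itv.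
apply: (@le_trans _ _ ((276 / 25 * K) ^+ 2)).
  have := mulr_ge0 (sqr_ge0 K) (_ : 0 <= 1 / 4 - K); rewrite subr_ge0 => /(_ K4).
  have := sqr_ge0 K; lra.
have M0 := le_trans K0 KM.
have cK0 : 0 <= 276 / 25 * K by lra.
by apply: lerXn2r; rewrite ?nnegrE; lra.
Qed.

Variables (w : {set G} -> R) (p : R).
Hypotheses (w_ge0 : forall S, 0 <= w S) (p_ge1 : 1 <= p).
Local Notation V :=
  (\sum_x mean (fun e => cut_dist w (x + sign_vector m e) x `^ p)).

Lemma sum_smoothing_error s :
  \sum_j \sum_x (\sum_S w S * `|med3 (local_density S j s x) - cut_ind R S x|) `^ p
  <= (27 / 8) `^ p * (n%:R * V).
Proof.
(* 27/8 is 9/8 from the smoothing times 3 from freezing a coordinate, and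
   3 <= 3 ^ p. *)
have step j x :
    (\sum_S w S * `|med3 (local_density S j s x) - cut_ind R S x|) `^ p <=
    (27 / 8) `^ p * mean (fun e => cut_dist w (x + sign_vector m e) x `^ p).
  apply: (@le_trans _ _ ((9 / 8 * mean (fun e =>
      cut_dist w (x + sign_vector m (update e j s)) x)) `^ p)).
    apply: ge0_ler_powR; rewrite ?nnegrE; first exact: le_trans p_ge1.
    - by apply: sumr_ge0 => S _; rewrite mulr_ge0.
    - by rewrite mulr_ge0// mean_ge0// => e; exact: cut_dist_ge0.
    rewrite -mean_cut_dist mulr_sumr; apply: ler_sum => S _.
    by rewrite mulrCA ler_wpM2l// smoothing_error.
  have c98 : 0 <= 9 / 8 :> R by lra.
  have -> : (27 / 8) `^ p = (9 / 8) `^ p * 3 `^ p.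
    by rewrite -powRM//; congr (_ `^ p); lra.
  rewrite powRM//; last by apply: mean_ge0 => e; exact: cut_dist_ge0.
  rewrite -mulrA; apply: ler_wpM2l; first exact: powR_ge0.
  apply: (@le_trans _ _ (mean (fun e =>
      cut_dist w (x + sign_vector m (update e j s)) x `^ p))).
    by apply: powR_mean; rewrite ?cube_gt0// => e; exact: cut_dist_ge0.
  apply: (@le_trans _ _ (3 * mean (fun e =>
      cut_dist w (x + sign_vector m e) x `^ p))).
    apply: (mean_update_le (h := fun e =>
      cut_dist w (x + sign_vector m e) x `^ p)) => e; exact: powR_ge0.
  apply: ler_wpM2r; first by apply: mean_ge0 => e; exact: powR_ge0.
  by rewrite le1r_powR//; lra.
apply: (@le_trans _ _ (\sum_(j < n) (27 / 8) `^ p * V)).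
  by apply: ler_sum => j _; rewrite mulr_sumr ler_sum.
by rewrite sumr_const card_ord -[leLHS]mulr_natr -mulrA ler_wpM2l ?powR_ge0// mulrC.
Qed.

(** The gradient bound holds for every cut at every point, so it can be integrated
    against the cut measure in l_2 before p-th powers are taken. *)
Lemma sum_smoothing_gradient q : p <= q -> 2 <= q -> (0 < n)%N ->
  \sum_j \sum_x (\sum_S w S * `|med3 (local_density S j ord_max x) -
                                med3 (local_density S j ord0 x)|) `^ p
  <= (276 / 25) `^ p * (n%:R `^ (1 - p / q) * V).
Proof.
move=> pq q2 n0; rewrite exchange_big/= mulr_sumr mulr_sumr.
apply: ler_sum => x _.
set M := mean (fun e => cut_dist w (x + sign_vector m e) x).
have M0 : 0 <= M by apply: mean_ge0 => e; exact: cut_dist_ge0.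
have [C CE C0] : exists2 C : R, C = 276 / 25 & 0 <= C by exists (276 / 25); lra.
rewrite -CE.
apply: (@le_trans _ _ (n%:R `^ (1 - p / q) * (C * M) `^ p)).
  apply: sum_powR_le_l2 => //.
  - by move=> j; rewrite sumr_ge0// => S _; rewrite mulr_ge0.
  - by rewrite mulr_ge0.
  rewrite /M -mean_cut_dist mulr_sumr.
  under [X in _ <= X ^+ 2]eq_bigr do rewrite mulrCA.
  apply: l2_sum_minkowski => // S.
    by rewrite mulr_ge0// mean_ge0.
  by rewrite CE; exact: smoothing_gradient.
rewrite powRM// mulrCA ler_wpM2l ?powR_ge0// ler_wpM2l ?powR_ge0//.
by apply: powR_mean; rewrite ?cube_gt0// => e; exact: cut_dist_ge0.
Qed.

End cut_metrics.

(** * The cotype inequality *)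

Section cut_cotype.
Variables (R : realType) (m n : nat).
Local Notation G := 'rV['Z_m]_n.

Lemma sum_translate (V : finZmodType) (F : V -> R) (t : V) :
  \sum_x F (x + t) = \sum_x F x.
Proof. by rewrite [RHS](reindex_inj (addIr t)). Qed.

Lemma four_quarter_le (l : nat) : (4 * l./2./2 <= l)%N.
Proof. by rewrite -!divn2 -divnMA mulnC leq_divM. Qed.

(** The inequality for cut metrics. Each displacement is split in three: the two
    smoothing errors at its ends, and the telescoping sum of the smoothed function
    over k steps of length 2. When m/2 is odd the walk stops one step short of the
    end point, which is compensated by freezing the j-th sign at -1 instead of 0
    there. *)
Lemma cut_dist_cotype (w : {set G} -> R) (p q : R) :
  (forall S, 0 <= w S) -> 1 <= p -> p <= q -> 2 <= q -> (0 < n)%N ->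
  n%:R <= m%:R `^ q ->
  \sum_(j < n) mean (fun x => cut_dist w (x + delta_mx 0 j *+ m./2) x `^ p)
  <= (951 / 100) `^ p * m%:R `^ p * n%:R `^ (1 - p / q) *
     mean (fun xe : G * {ffun 'I_n -> 'I_3} =>
       cut_dist w (xe.1 + sign_vector m xe.2) xe.1 `^ p).
Proof.
move=> w0 p1 pq q2 n0 nm.
have p0 : 0 <= p by exact: le_trans p1.
set D := n%:R `^ (1 - p / q).
have D0 : 0 <= D by exact: powR_ge0.
have mR : 0 < m%:R :> R.
  rewrite ltr0n lt0n; apply: contraTneq nm => ->.
  by rewrite powR0 ?lern0 -?lt0n//; lra.
set V := \sum_x mean (fun e => cut_dist w (x + sign_vector m e) x `^ p).
have V0 : 0 <= V.
  by apply: sumr_ge0 => x _; apply: mean_ge0 => e; exact: powR_ge0.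
have meanV : mean (fun xe : G * {ffun 'I_n -> 'I_3} =>
    cut_dist w (xe.1 + sign_vector m xe.2) xe.1 `^ p) = V / #|{: G}|%:R.
  rewrite /mean /V /mean -mulr_suml pair_bigA/= card_prod natrM invfM mulrA.
  by rewrite mulrAC.
rewrite meanV -mulr_suml mulrA ler_wpM2r ?invr_ge0// -!mulrA.
rewrite (_ : m%:R `^ p * (D * V) = m%:R `^ p * D * V); last by rewrite mulrA.
pose k := (m./2)./2; pose r := odd m./2.
have mk : m./2 = (r + k.*2)%N by rewrite odd_double_half.
pose s := if r then ord0 else mid3 : 'I_3.
pose e_ (j : 'I_n) : G := delta_mx 0 j.
pose g (j : 'I_n) (S : {set G}) (x : G) : R := smoothing R S j x.
pose u (i : 'I_3) (jx : 'I_n * G) : R :=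
  let: (j, x) := jx in
  if i == ord0 then
    \sum_S w S * `|med3 (local_density R S j s (x + e_ j *+ m./2)) -
                   cut_ind R S (x + e_ j *+ m./2)|
  else if i == mid3 then
    \sum_(l < k) \sum_S w S * `|g j S (x + e_ j *+ l.*2 + e_ j *+ 2) -
                                 g j S (x + e_ j *+ l.*2)|
  else \sum_S w S * `|med3 (local_density R S j mid3 x) - cut_ind R S x|.
(* p-norms of the pieces; 69/25 is (276/25)/4, because 4 k <= m. *)
pose A (i : 'I_3) : R := if i == mid3 then 69 / 25 * m%:R else 27 / 8 * m%:R.
have u0 i jx : 0 <= u i jx.
  case: jx => j x; rewrite /u; case: ifP => _; [|case: ifP => _].
  - by apply: sumr_ge0 => S _; rewrite mulr_ge0.
  - by apply: sumr_ge0 => l _; apply: sumr_ge0 => S _; rewrite mulr_ge0.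
  - by apply: sumr_ge0 => S _; rewrite mulr_ge0.
have dist_u j x : cut_dist w (x + e_ j *+ m./2) x <= \sum_i u i (j, x).
  rewrite !big_ord_recl big_ord0 addr0 /u/=.
  rewrite exchange_big/= -!big_split/=; apply: ler_sum => S _.
  rewrite -mulr_sumr -!mulrDr; apply: ler_wpM2l => //.
  have -> : local_density R S j s (x + e_ j *+ m./2) =
      local_density R S j mid3 (x + e_ j *+ k.*2).
    rewrite /s mk; case: (r) => //.
    by rewrite addnC addn1 mulrSr addrA (local_density_shift R S j _).1.
  set h' := cut_ind R S (x + e_ j *+ m./2).
  have tele l : `|g j S (x + e_ j *+ l.*2) - g j S x| <= \sum_(i < l)
      `|g j S (x + e_ j *+ i.*2 + e_ j *+ 2) - g j S (x + e_ j *+ i.*2)|.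
    elim: l => [|l IHl]; first by rewrite mulr0n addr0 subrr normr0 big_ord0.
    rewrite big_ord_recr/=; have := ler_distD (g j S (x + e_ j *+ l.*2))
      (g j S (x + e_ j *+ l.+1.*2)) (g j S x).
    move=> /le_trans; apply; rewrite addrC lerD//.
    by rewrite doubleS -addn2 mulrnDr addrA.
  have := tele k; rewrite /g /smoothing.
  set a := med3 _; set b := med3 _ => tk.
  apply: (le_trans (ler_distD a _ _)); rewrite distrC lerD2l.
  by apply: (le_trans (ler_distD b _ _)); rewrite lerD2r.
have uA i : \sum_jx u i jx `^ p <= A i `^ p * (D * V).
  have qne : q != 0 by lra.
  (* The n error terms of each kind are paid for by n <= m^q. *)
  have nD : n%:R <= m%:R `^ p * D.
    have -> : n%:R = n%:R `^ (p / q) * D.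
      by rewrite -powRD ?subrKC ?powRr1// oner_eq0.
    apply: ler_wpM2r => //.
    rewrite (_ : m%:R `^ p = (m%:R `^ q) `^ (p / q)); last first.
      by rewrite -powRrM; congr (_ `^ _); field.
    by apply: ge0_ler_powR; rewrite ?nnegrE ?powR_ge0// divr_ge0//; lra.
  rewrite /A; have [i1|i1] := eqVneq i mid3.
    have [C CE C0] : exists2 C : R, C = 276 / 25 & 0 < C by exists (276 / 25); lra.
    have Ck : \sum_(l < k) C <= 69 / 25 * m%:R.
      rewrite sumr_const card_ord -[leLHS]mulr_natr CE.
      have : 4 * k%:R <= m%:R :> R by rewrite -natrM ler_nat four_quarter_le.
      by lra.
    have Ck0 : 0 <= \sum_(l < k) C by apply: sumr_ge0 => l _; exact: ltW.
    apply: (@le_trans _ _ ((\sum_(l < k) C) `^ p * (D * V))); last first.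
      apply: ler_wpM2r; first exact: mulr_ge0.
      by apply: ge0_ler_powR; rewrite ?nnegrE// (le_trans Ck0).
    pose v (l : 'I_k) (jx : 'I_n * G) : R := \sum_S w S *
      `|g jx.1 S (jx.2 + e_ jx.1 *+ l.*2 + e_ jx.1 *+ 2) -
        g jx.1 S (jx.2 + e_ jx.1 *+ l.*2)|.
    rewrite (eq_bigr (fun jx => (\sum_l v l jx) `^ p)); last first.
      by move=> [j x] _; rewrite /u i1.
    apply: sum_powR_minkowski => // [l jx|l].
      by apply: sumr_ge0 => S _; rewrite mulr_ge0.
    rewrite CE; apply: le_trans (sum_smoothing_gradient w0 p1 pq q2 n0).
    under [leRHS]eq_bigr => j _ do
      rewrite -(sum_translate _ (e_ j *+ l.*2 + e_ j)).
    rewrite pair_bigA/=; apply: ler_sum => -[j x] _ /=.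
    rewrite le_eqVlt; apply/orP; left; apply/eqP; congr (_ `^ p).
    apply: eq_bigr => S _; congr (_ * `|_ - _|); congr med3.
      by rewrite mulr2n 2!addrA (local_density_shift R S j _).2 -addrA.
    by rewrite addrA (local_density_shift R S j _).1.
  rewrite powRM ?(ltW mR)//.
  apply: (@le_trans _ _ ((27 / 8) `^ p * (n%:R * V))); last first.
    rewrite -[leRHS]mulrA ler_wpM2l ?powR_ge0//.
    by rewrite [leRHS]mulrA ler_wpM2r.
  have [i0|i0] := eqVneq i ord0.
    apply: le_trans (sum_smoothing_error w0 p1 s).
    under [leRHS]eq_bigr => j _ do rewrite -(sum_translate _ (e_ j *+ m./2)).
    rewrite pair_bigA/=; apply: ler_sum => -[j x] _ /=.
    by rewrite /u i0.
  apply: le_trans (sum_smoothing_error w0 p1 mid3).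
  rewrite pair_bigA/=; apply: ler_sum => -[j x] _ /=.
  by rewrite /u (negPf i0) (negPf i1) lexx.
apply: (@le_trans _ _ (\sum_jx (\sum_i u i jx) `^ p)).
  rewrite pair_bigA; apply: ler_sum => -[j x] _.
  apply: ge0_ler_powR; rewrite ?nnegrE//.
  - exact: cut_dist_ge0.
  - by apply: sumr_ge0 => i _; exact: u0.
have A0 i : 0 < A i by rewrite /A; case: ifP => _; lra.
apply: (le_trans (sum_powR_minkowski p1 A0 u0 uA)).
have [c cE c0] : exists2 c : R, c = 951 / 100 & 0 <= c by exists (951 / 100); lra.
have -> : \sum_i A i = c * m%:R.
  by rewrite !big_ord_recl big_ord0 addr0 /A/= cE; lra.
by rewrite -cE powRM ?(ltW mR)// !mulrA.
Qed.

End cut_cotype.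

Section cotype_of_cuts.
Variables (R : realType) (m n : nat).

(** A bi-Lipschitz comparison with a cut metric, of distortion [b / a], costs that
    factor in the constant. *)
Lemma cotype_ineq_of_cuts (M : metricType R) (f : 'rV['Z_m]_n -> M)
    (w : {set 'rV['Z_m]_n} -> R) (a b C p q : R) :
  (forall S, 0 <= w S) -> 0 < a -> 0 <= b ->
  (forall x y, a * mdist (f x) (f y) <= cut_dist w x y) ->
  (forall x y, cut_dist w x y <= b * mdist (f x) (f y)) ->
  951 / 100 * b <= C * a ->
  1 <= p -> p <= q -> 2 <= q -> (0 < n)%N -> n%:R <= m%:R `^ q ->
  cotype_ineq p q C f.
Proof.
move=> w0 a0 b0 lo hi Cab p1 pq q2 n0 nm; rewrite /cotype_ineq.
have p0 : 0 <= p by exact: le_trans p1.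
have [c cE c0] : exists2 c : R, c = 951 / 100 & 0 <= c by exists (951 / 100); lra.
have ap : 0 < a `^ p by exact: powR_gt0.
have C0 : 0 <= C.
  by rewrite -(pmulr_lge0 _ a0); apply: le_trans Cab; rewrite -cE mulr_ge0.
set J := \sum_j _; set K := m%:R `^ p; set D := n%:R `^ _; set V := mean _.
rewrite -(ler_pM2l ap).
have dist0 x y : 0 <= mdist (f x) (f y) by exact: mdist_ge0.
have := cut_dist_cotype w0 p1 pq q2 n0 nm; rewrite -cE -/K -/D.
set J' := \sum_j _; set V' := mean _ => core.
have JJ' : a `^ p * J <= J'.
  rewrite mulr_sumr; apply: ler_sum => j _; rewrite -meanZ; apply: ler_mean => x.
  rewrite -powRM ?(ltW a0)//; apply: ge0_ler_powR; rewrite ?nnegrE//.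
  - by rewrite mulr_ge0 ?(ltW a0).
  - exact: cut_dist_ge0.
have VV' : V' <= b `^ p * V.
  rewrite -meanZ; apply: ler_mean => x.
  rewrite -powRM//; apply: ge0_ler_powR; rewrite ?nnegrE//.
  - exact: cut_dist_ge0.
  - by rewrite mulr_ge0.
have V0 : 0 <= V by apply: mean_ge0 => x; exact: powR_ge0.
apply: (le_trans JJ'); apply: (le_trans core).
apply: (@le_trans _ _ (c `^ p * K * D * (b `^ p * V))).
  by rewrite ler_wpM2l// !mulr_ge0 ?powR_ge0.
have -> : c `^ p * K * D * (b `^ p * V) = (c * b) `^ p * (K * D * V).
  by rewrite powRM//; ring.
have -> : a `^ p * (C `^ p * K * D * V) = (C * a) `^ p * (K * D * V).
  by rewrite powRM ?(ltW a0)//; ring.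
have K0 : 0 <= K by exact: powR_ge0.
have D0 : 0 <= D by exact: powR_ge0.
apply: ler_wpM2r; first exact: mulr_ge0 (mulr_ge0 K0 D0) V0.
by apply: ge0_ler_powR; rewrite ?nnegrE ?mulr_ge0 ?(ltW a0)// cE.
Qed.

End cotype_of_cuts.

Theorem corollary1p2 (R : realType) :
  (forall (q p : R) (m n : nat),
     2 <= q -> 1 <= p -> p <= q ->
     (4 <= m)%N -> ~~ odd m -> (1 <= n)%N -> n%:R <= m%:R `^ q ->
     forall M : metricType R, is_L1 M ->
     forall f : 'rV['Z_m]_n -> M, cotype_ineq p q 11 f) /\
  (forall (q p : R) (n : nat),
     2 <= q -> 1 <= p -> p <= q -> (1 <= n)%N ->
     (cotype_const_p (@is_L1 R) p q n 11 <= (6 * n%:R `^ q^-1)%:E)%E) /\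
  (forall n : nat, (1 <= n)%N ->
     (cotype_const (@is_L1 R) 2 n 11 <= (6 * Num.sqrt n%:R)%:E)%E).
Proof.
have ineq (q p : R) (m n : nat) : 2 <= q -> 1 <= p -> p <= q -> (1 <= n)%N ->
    n%:R <= m%:R `^ q -> forall M : metricType R, is_L1 M ->
    forall f : 'rV['Z_m]_n -> M, cotype_ineq p q 11 f.
  move=> q2 p1 pq n1 nm M [] d T mu f.
    have [w w0 wE] := real_L1_cuts f.
    apply: (@cotype_ineq_of_cuts R m n _ f w 1 1) => // [x y|x y|].
    - by rewrite mul1r wE.
    - by rewrite mul1r wE.
    - by lra.
  have [w w0 wE] := complex_L1_cuts f.
  have s3 : 173 / 100 <= Num.sqrt 3 :> R.
    rewrite -(ler_pXn2r (n := 2)) ?nnegrE ?sqrtr_ge0 ?sqr_sqrtr//; lra.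
  apply: (@cotype_ineq_of_cuts R m n _ f w (Num.sqrt 3) 2) => // [x y|x y|].
  - exact: (wE x y).1.
  - exact: (wE x y).2.
  - by lra.
have const (q p : R) (n : nat) : 2 <= q -> 1 <= p -> p <= q -> (1 <= n)%N ->
    (cotype_const_p (@is_L1 R) p q n 11 <= (6 * n%:R `^ q^-1)%:E)%E.
  move=> q2 p1 pq n1; set N := n%:R `^ q^-1.
  have q0 : q != 0 by lra.
  have N1 : 1 <= N.
    have one : 1 `^ q^-1 = 1 :> R by rewrite powR1.
    rewrite -[leLHS]one; apply: ge0_ler_powR; rewrite ?nnegrE ?ler1n//.
    by rewrite invr_ge0; lra.
  have N0 : 0 <= N by exact: le_trans N1.
  (* An even number at least N, at least 4 as N >= 1, and at most 2 N + 2 <= 4 N. *)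
  pose m := (Num.truncn N).*2.+2.
  have /andP[tN Nt] := truncn_itv N0.
  have mN : m%:R = 2 * (Num.truncn N)%:R + 2 :> R.
    by rewrite /m -addn2 natrD -mul2n natrM.
  have nm : n%:R <= m%:R `^ q.
    have -> : n%:R = N `^ q by rewrite -powRrM mulVf ?powRr1.
    apply: ge0_ler_powR; rewrite ?nnegrE//; first by lra.
    by rewrite mN; rewrite -natr1 in Nt; lra.
  have scale : cotype_scale (@is_L1 R) p q n 11 m.
    rewrite /cotype_scale/= /m /= odd_double/=; apply/asboolP.
    by move=> M L1M f; exact: ineq.
  rewrite /cotype_const_p; case: pselect => [exm|]; last by case; exists m.
  rewrite lee_fin; case: ex_minnP => k _ /(_ m scale) km.
  apply: (@le_trans _ _ m%:R); first by rewrite ler_nat.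
  by rewrite mN; lra.
split; [|split] => //.
  by move=> q p m n q2 p1 pq _ _ n1 nm M L1M f; exact: ineq.
move=> n n1; rewrite -powR12_sqrt//; apply: const => //.
by lra.
Qed.
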